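(* Let $\sigma$ be a surjective endomorphism of $(X,\mathcal B,\mu)$ with $\mu$ $\sigma$-invariant. Let $(m_i : i\in\Lambda)$ ($\Lambda$ finite or countable) be a set of cyclic vectors for the representation of $L^\infty(X,\sigma^{-1}(\mathcal B),\mu)$ on $L^2(\mu)$ by multiplication operators, satisfying $S_\sigma^*(|m_i|^2)=\mathbf 1$ for all $i\in\Lambda$, and let $S_i(f)=m_i(f\circ\sigma)$ for $f\in L^2(\mu)$. Then $\underline m=(m_i)$ is a wavelet filter, i.e. $\underline m\in\mathfrak M$, if and only if $\sum_{i\in\Lambda}S_iS_i^*=\mathbb I$. In other words, $\underline m\in\mathfrak M$ if and only if the operators $S_i$, $i\in\Lambda$, are the generators of a representation of the Cuntz algebra $\mathcal O_{|\Lambda|}$.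
   Context: $(X,\mathcal B)$ is a standard Borel space, $\mu$ a non-atomic Borel probability measure, $\sigma:X\to X$ a measurable surjection with $\mu(\sigma^{-1}(A))=\mu(A)$ for all $A\in\mathcal B$. Functions are identified $\mu$-a.e. and $L^2(\mu)$ is complex-valued. $S_\sigma(f)=f\circ\sigma$ on $L^2(\mu)$, with adjoint $S_\sigma^*(g)=\frac{(g\,d\mu)\circ\sigma^{-1}}{d\mu}$ (Radon–Nikodym derivative of $A\mapsto\int_{\sigma^{-1}(A)}g\,d\mu$ with respect to $\mu$); this formula also defines $S_\sigma^*(g)$ for $g\in L^1(\mu)$. $\mathbb E_\sigma(g)=S_\sigma S_\sigma^*(g)=S_\sigma^*(g)\circ\sigma$ is the conditional expectation onto $\sigma^{-1}(\mathcal B)$. ''Set of cyclic vectors'' means: each $m_i\in L^2(\mu)$, and with $\mathcal H_i$ the closure in $L^2(\mu)$ of $\{\gamma m_i:\gamma\in L^\infty(X,\sigma^{-1}(\mathcal B),\mu)\}$ one has the orthogonal decomposition $L^2(\mu)=\bigoplus_{i\in\Lambda}\mathcal H_i$ (decomposition of the representation into orthogonal cyclic representations). The set of wavelet filters is $\mathfrak M=\{\underline m=(m_i)_{i\in\Lambda}: S_\sigma^*(m_i\overline{m_j})=\delta_{ij}\mathbf 1 \text{ for all } i,j,\ \sum_{i\in\Lambda}m_i\mathbb E_\sigma(\overline{m_i}f)=f\ \text{for all } f\in L^2(\mu)\}$. Operators $S_i$ are generators of a representation of $\mathcal O_{|\Lambda|}$ if they are isometries with mutually orthogonal projections $S_iS_i^*$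 and $\sum_i S_iS_i^*=\mathbb I$ (strongly). $\mathbf 1$ is the constant function $1$. *)

(* Defs.v *)
From HB Require Import structures.
From mathcomp Require Import all_boot all_order all_algebra finmap.
From mathcomp Require Import complex.
From mathcomp Require Import all_classical all_reals all_analysis.
From mathcomp Require Import summability.
Set Implicit Arguments.
Unset Strict Implicit.
Unset Printing Implicit Defensive.
Import Order.TTheory GRing.Theory Num.Theory.
Import numFieldNormedType.Exports.
Import Normc.

Local Open Scope classical_set_scope.
Local Open Scope ring_scope.
Local Open Scope charge_scope.
Local Open Scope complex_scope.

(* The sigma-algebra of X is the Borel sigma-algebra of a Polish topology,
   transported along the bijection phi. Completeness of M together with
   hausdorff_space M says that the topology of M is completely metrizable. *)
Definition standard_borel (R : realType) d (X : measurableType d) : Prop :=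
  exists (M : completePseudoMetricType R) (phi : X -> M),
    [/\ bijective phi, hausdorff_space M,
        (exists2 D : set M, countable D & dense D) &
        (measurable : set (set X)) =
          preimage_set_system [set: X] phi <<s (open : set (set M)) >>].

Section Definitions.
Context (R : realType) (d : measure_display) (X : measurableType d).
Variable mu : probability X R.
Implicit Types f g h m : X -> R[i].

Definition nonatomic : Prop :=
  forall A, measurable A -> (0 < mu A)%E ->
  exists B, [/\ measurable B, B `<=` A, (0 < mu B)%E & (mu B < mu A)%E].

(** Complex-valued function spaces. Vectors are functions; equality in
    [L^2(mu)] is [_ = _ %[ae mu]]. *)

Definition cmeasurable f : Prop :=
  measurable_fun [set: X] (fun x => complex.Re (f x)) /\
  measurable_fun [set: X] (fun x => complex.Im (f x)).

Definition cabs f : X -> R := fun x => normc (f x).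

Definition cLfun (p : \bar R) f : Prop := cmeasurable f /\ cabs f \in Lfun mu p.

Definition cLnorm (p : \bar R) f : R := fine ('N[mu]_p [EFin \o cabs f])%E.

Local Notation L2 := (cLfun 2%:E).
Local Notation norm2 := (cLnorm 2%:E).

Definition cintegral f : R[i] :=
  (\int[mu]_x complex.Re (f x)) +i* (\int[mu]_x complex.Im (f x)).

Definition inner f g : R[i] := cintegral (fun x => f x * (g x)^*).

(* Convergence in L^2 of the net of finite partial sums. *)
Definition L2_has_sum (I : choiceType) (F : I -> X -> R[i]) f : Prop :=
  (forall i, L2 (F i)) /\
  (fun J : {fset I} => norm2 (fun x => f x - \sum_(i <- J) F i x)) @ totally
    --> (0 : R).

(** Operators on [L^2(mu)]. *)

Definition L2_operator (T : (X -> R[i]) -> X -> R[i]) : Prop :=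
  [/\ forall f, L2 f -> L2 (T f),
      forall f g, L2 f -> L2 g -> f = g %[ae mu] -> T f = T g %[ae mu] &
      forall (a : R[i]) f g, L2 f -> L2 g ->
        T (fun x => a * f x + g x) = (fun x => a * T f x + T g x) %[ae mu]].

Definition L2_isometry (T : (X -> R[i]) -> X -> R[i]) : Prop :=
  L2_operator T /\ forall f, L2 f -> norm2 (T f) = norm2 f.

(* A representative of the Hilbert space adjoint, by choice; for a bounded T
   the class is determined by the Riesz representation theorem. *)
Definition adjoint (T : (X -> R[i]) -> X -> R[i]) g : X -> R[i] :=
  xget (cst 0) [set h | L2 h /\ forall f, L2 f -> inner (T f) g = inner f h].

Definition strong_sum_is_id (I : choiceType)
    (T : I -> (X -> R[i]) -> X -> R[i]) : Prop :=
  forall f, L2 f -> L2_has_sum (fun i => T i f) f.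

Definition TTadj (T : (X -> R[i]) -> X -> R[i]) f : X -> R[i] :=
  T (adjoint T f).

Definition cuntz_generators (I : choiceType)
    (S : I -> (X -> R[i]) -> X -> R[i]) : Prop :=
  [/\ forall i, L2_isometry (S i),
      forall i j f, i != j -> L2 f ->
        TTadj (S i) (TTadj (S j) f) = cst 0 %[ae mu] &
      strong_sum_is_id (fun i => TTadj (S i))].

Variable sigma : {mfun X >-> X}.

Definition measure_invariant : Prop :=
  forall A, measurable A -> mu (sigma @^-1` A) = mu A.

(* A |-> \int_(sigma^-1 A) u dmu *)
Definition push_charge (u : X -> R)
    (iu : mu.-integrable [set: X] (EFin \o u)) : set X -> \bar R :=
  pushforward (induced_charge iu) sigma.

Section PushCharge.
Variables (u : X -> R) (iu : mu.-integrable [set: X] (EFin \o u)).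

Let push_charge0 : push_charge iu set0 = 0%E.
Proof. by rewrite /push_charge /pushforward preimage_set0 charge0. Qed.

Let push_charge_fin A : measurable A -> push_charge iu A \is a fin_num.
Proof.
move=> mA; apply: (fin_num_measure (induced_charge iu)).
by rewrite -(setTI (_ @^-1` _)); exact: (measurable_funPT sigma).
Qed.

Let push_charge_sigma_additive : semi_sigma_additive (push_charge iu).
Proof.
rewrite /push_charge; apply: charge_semi_sigma_additive.
exact: measurable_funPT.
Qed.

HB.instance Definition _ :=
  isCharge.Build d X R (push_charge iu)
    push_charge0 push_charge_fin push_charge_sigma_additive.

End PushCharge.

(* The Radon-Nikodym derivative of push_charge, meaningful for u in L^1 and
   sigma invariant (then push_charge is dominated by mu). *)
Definition Sstar_real (u : X -> R) : X -> R :=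
  match pselect (mu.-integrable [set: X] (EFin \o u)) with
  | left iu => fine \o 'd (push_charge iu) '/d mu
  | right _ => cst 0
  end.

Definition Sstar g : X -> R[i] := fun x =>
  Sstar_real (fun y => complex.Re (g y)) x +i*
  Sstar_real (fun y => complex.Im (g y)) x.

Definition Esigma g : X -> R[i] := Sstar g \o sigma.

(* L^oo(X, sigma^-1(B), mu) *)
Definition Linfty_sigma (gamma : X -> R[i]) : Prop :=
  [/\ forall B : set R, measurable B ->
        preimage_set_system [set: X] sigma measurable
          ((fun x => complex.Re (gamma x)) @^-1` B),
      forall B : set R, measurable B ->
        preimage_set_system [set: X] sigma measurable
          ((fun x => complex.Im (gamma x)) @^-1` B) &
      cLfun +oo%E gamma].

(* The closure in L^2 of { gamma m | gamma in L^oo(X, sigma^-1(B), mu) }. *)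
Definition cyclic_subspace m : set (X -> R[i]) :=
  [set f | L2 f /\ forall e : R, 0 < e ->
     exists2 gamma, Linfty_sigma gamma &
       norm2 (fun x => f x - gamma x * m x) < e].

Definition cyclic_vectors (I : choiceType) (m : I -> X -> R[i]) : Prop :=
  [/\ forall i, L2 (m i),
      forall i j f g, i != j -> cyclic_subspace (m i) f ->
        cyclic_subspace (m j) g -> inner f g = 0 &
      forall f, L2 f -> exists2 F : I -> X -> R[i],
        (forall i, cyclic_subspace (m i) (F i)) & L2_has_sum F f].

Definition wavelet_filters (I : choiceType) : set (I -> X -> R[i]) :=
  [set m | [/\ forall i, L2 (m i),
      forall i j, Sstar (fun x => m i x * (m j x)^*) =
        cst ((i == j)%:R) %[ae mu] &
      forall f, L2 f ->
        L2_has_sum (fun i x => m i x * Esigma (fun y => (m i y)^* * f y) x) f]].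

Definition filter_op m : (X -> R[i]) -> X -> R[i] :=
  fun f x => m x * f (sigma x).

End Definitions.

(* Main.v *)
Require Import Defs.
From HB Require Import structures.
From mathcomp Require Import all_boot all_order all_algebra finmap.
From mathcomp Require Import complex.
From mathcomp Require Import all_classical all_reals all_analysis.
From mathcomp Require Import measurable_realfun ess_sup_inf.
From mathcomp Require Import ring lra.
Set Implicit Arguments.
Unset Strict Implicit.
Unset Printing Implicit Defensive.
Import Order.TTheory GRing.Theory Num.Theory.
Import numFieldNormedType.Exports.
Import Normc.

Local Open Scope classical_set_scope.
Local Open Scope complex_scope.
Local Open Scope ring_scope.

(** The two conditions turn out to be the same formula. Write
    [T_m g := Sstar (conj m * g)]. The change of variables
      [int u * (k \o sigma) = int (Sstar u) * k]
    shows that [T_m] is the Hilbert space adjoint of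
    [S_m f := m * (f \o sigma)], so that
      [S_m (S_m^* f) = (T_m f \o sigma) * m = m * Esigma (conj m * f)]
    almost everywhere: the series in the definition of a wavelet filter is,
    term by term, the series of the range projections of the [S_i].

    For this to make sense [T_m] has to map [L^2] into [L^2]
    ([L2_coeff]). The normalization [Sstar |m|^2 = 1] makes [S_m] an isometry
    ([filter_op_integral]), and boundedness of [T_m] follows by duality: with
    [h := T_m g] cut off where [|h| > n],
      [int_(|h| <= n) |h|^2 = Re <g, S_m (h 1_(|h| <= n))>
          <= (int_(|h| <= n) |h|^2 + int |g|^2) / 2],
    hence [int_(|h| <= n) |h|^2 <= int |g|^2] for every [n], and monotone
    convergence concludes.

    The remaining clause of the definition of a wavelet filter,
    [Sstar (m_i * conj m_j) = delta_ij], follows from the cyclic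
    decomposition: on the diagonal it is the normalization, and off the
    diagonal the orthogonality of [1_(sigma^-1 A) * m_i] and [m_j] says that
    the measure with density [m_i * conj m_j], pushed forward by [sigma],
    vanishes on every [A] ([cyclic_orthogonal_Sstar]). Through the change of
    variables, the same identity makes the ranges of [S_i] and [S_j]
    orthogonal ([TTadj_orthogonal]). So the Cuntz relations other than the
    summation formula hold for every normalized cyclic family, and both
    equivalences reduce to replacing each term of a series by an almost
    everywhere equal one ([L2_has_sum_ae_eq]).

    The change of variables is proved for nonnegative weights by simple
    functions ([ge0_integral_weight_transfer]), for a signed weight [u] by
    writing [u = (u + |u|) - |u|] ([transfers_integral]), and for complex
    ones componentwise ([Sstar_integral]). *)

(** * Change of variables for nonnegative weights *)

Section WeightedTransfer.
Context (R : realType) (d : measure_display) (X : measurableType d).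
Variable mu : {measure set X -> \bar R}.
Local Open Scope ereal_scope.
Import HBNNSimple.

(** Only the masses that [w] gives to the level sets of [s \o phi] enter the
    right-hand side, so weights with the same image measure have the same
    integrals against simple functions. *)
Lemma integral_weight_nnsfun (phi : X -> X) (w : X -> R)
    (s : {nnsfun X >-> R}) :
  measurable_fun [set: X] phi -> measurable_fun [set: X] w ->
  (forall x, 0 <= w x)%R ->
  \int[mu]_x (w x * s (phi x))%:E =
  \sum_(y \in range s) y%:E * \int[mu]_(x in phi @^-1` (s @^-1` [set y])) (w x)%:E.
Proof.
move=> mphi mw w0; pose W := EFin \o w.
have W0 x : 0 <= W x by rewrite lee_fin.
have mlevel y : measurable (phi @^-1` (s @^-1` [set y])).
  by rewrite -(setTI (phi @^-1` _)); apply: mphi.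
have mpiece y : measurable_fun [set: X]
    (W \_ (phi @^-1` (s @^-1` [set y])) : X -> \bar R).
  by apply/(measurable_restrictT W) => //; exact/measurable_funTS/measurable_EFinP.
transitivity (\int[mu]_x \sum_(y \in range s)
    y%:E * (W \_ (phi @^-1` (s @^-1` [set y]))) x).
  apply: eq_integral => x _.
  have sx : range s (s (phi x)) by exists (phi x).
  rewrite (fsbigD1 (s (phi x)))//=.
  rewrite [X in _ = _ + X]fsbig1 ?adde0; last first.
    move=> y [_ ysx]; rewrite patchE ifF ?mule0//; apply/negbTE/negP.
    by rewrite inE/= => sxy; apply: ysx.
  by rewrite patchE ifT ?inE// EFinM muleC.
rewrite ge0_integral_fsum//.
- apply: eq_fsbigr => y /set_mem[x _ <-].
  rewrite [in RHS]integral_mkcond ge0_integralZl ?lee_fin//.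
  by move=> z _; exact: erestrict_ge0.
- by move=> y; exact: measurable_funeM.
- move=> y x _; rewrite patchE; case: ifPn => [|_]; last by rewrite mule0.
  by rewrite inE/= => <-; rewrite mule_ge0 ?lee_fin.
Qed.

(** Both sides are integrals against simple functions followed by a monotone
    limit, the right-hand side being the case of the identity map. *)
Lemma ge0_integral_weight_transfer (phi : X -> X) (u w k : X -> R) :
  measurable_fun [set: X] phi ->
  measurable_fun [set: X] u -> (forall x, 0 <= u x)%R ->
  measurable_fun [set: X] w -> (forall x, 0 <= w x)%R ->
  (forall A, measurable A ->
    \int[mu]_(x in phi @^-1` A) (u x)%:E = \int[mu]_(x in A) (w x)%:E) ->
  measurable_fun [set: X] k -> (forall x, 0 <= k x)%R ->
  \int[mu]_x (u x * k (phi x))%:E = \int[mu]_x (w x * k x)%:E.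
Proof.
move=> mphi mes_u u0 mw w0 uw mk k0.
have mK : measurable_fun [set: X] (EFin \o k) by exact/measurable_EFinP.
pose s := nnsfun_approx measurableT mK.
have approx (psi : X -> X) (v : X -> R) : measurable_fun [set: X] psi ->
    measurable_fun [set: X] v -> (forall x, 0 <= v x)%R ->
    \int[mu]_x (v x * k (psi x))%:E =
    limn (fun n => \int[mu]_x (v x * s n (psi x))%:E).
  move=> mpsi mv v0; rewrite -monotone_convergence//.
  - apply: eq_integral => x _; apply/esym/cvg_lim => //.
    under eq_fun do rewrite EFinM; rewrite EFinM; apply: cvgeZl => //.
    by apply: (cvg_nnsfun_approx measurableT mK) => // z _; rewrite lee_fin.
  - move=> n; apply/measurable_EFinP; apply: measurable_funM => //.
    exact: measurableT_comp.
  - by move=> n x _; rewrite lee_fin mulr_ge0.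
  - move=> x _ a b ab; rewrite lee_fin ler_wpM2l//.
    exact/lefP/nd_nnsfun_approx.
rewrite approx// (approx id)//; congr (limn _); apply/funext => n.
rewrite integral_weight_nnsfun// (integral_weight_nnsfun (phi := id))//.
by apply: eq_fsbigr => y _; rewrite uw//.
Qed.

End WeightedTransfer.

(** * Change of variables for signed weights *)

Section RealTransfer.
Local Open Scope charge_scope.
Context (R : realType) (d : measure_display) (X : measurableType d).
Variables (mu : probability X R) (sigma : {mfun X >-> X}).

Local Notation integrable f := (mu.-integrable [set: X] (EFin \o f)).

Let measurable_sigma : measurable_fun [set: X] sigma.
Proof. exact: measurable_funPT. Qed.

Let measurable_preimage_sigma A : measurable A -> measurable (sigma @^-1` A).
Proof. by move=> mA; rewrite -(setTI (_ @^-1` _)); exact: measurable_sigma. Qed.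

Lemma integrable_ae_eq (f g : X -> R) : measurable_fun [set: X] g ->
  f = g %[ae mu] -> integrable f -> integrable g.
Proof.
move=> mg fg /integrableP[mf foo].
apply/integrableP; split; first exact/measurable_EFinP.
rewrite (@ge0_ae_eq_integral _ _ _ mu setT _ (fun x => `|(f x)%:E|%E))//.
- by apply: measurableT_comp => //; exact/measurable_EFinP.
- exact: measurableT_comp.
- by apply: filterS fg => x fgx _ /=; rewrite fgx.
Qed.

Lemma Rintegral_ae_eq (f g : X -> R) :
  measurable_fun [set: X] f -> measurable_fun [set: X] g ->
  f = g %[ae mu] -> \int[mu]_x f x = \int[mu]_x g x.
Proof.
move=> mf mg fg; congr fine; apply: ae_eq_integral => //.
- exact/measurable_EFinP.
- exact/measurable_EFinP.
- by apply: filterS fg => x fgx _ /=; rewrite fgx.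
Qed.

(** This is [Sstar_real u = w] up to null sets, phrased without choosing a
    Radon-Nikodym derivative, which makes it stable under sums. *)
Definition transfers (u w : X -> R) : Prop :=
  [/\ integrable u, integrable w & forall A, measurable A ->
    (\int[mu]_(x in sigma @^-1` A) (u x)%:E = \int[mu]_(x in A) (w x)%:E)%E].

Lemma transfersD u1 w1 u2 w2 : transfers u1 w1 -> transfers u2 w2 ->
  transfers (u1 \+ u2) (w1 \+ w2).
Proof.
move=> [iu1 iw1 uw1] [iu2 iw2 uw2]; split=> [||A mA].
- by have := integrableD measurableT iu1 iu2.
- by have := integrableD measurableT iw1 iw2.
- have mA' := measurable_preimage_sigma mA.
  have iS (B : set X) f : measurable B -> integrable f ->
    mu.-integrable B (EFin \o f) by move=> mB; exact: integrableS.
  under eq_integral do rewrite EFinD.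
  under [RHS]eq_integral do rewrite EFinD.
  rewrite integralD//; [|exact: iS..].
  by rewrite integralD//; [rewrite uw1// uw2|exact: iS..].
Qed.

(** On the set [N] where [w < 0], the integral of [w] is that of [u] over
    [sigma^-1 N], hence nonnegative; so [w] vanishes almost everywhere
    on [N]. *)
Lemma transfers_ge0 u w : transfers u w -> (forall x, 0 <= u x) ->
  {ae mu, forall x, 0 <= w x}.
Proof.
move=> [_ iw uw] u0.
have mw : measurable_fun [set: X] w.
  by apply/measurable_EFinP; exact: measurable_int iw.
pose N := [set x | w x < 0].
have mN : measurable N.
  rewrite (_ : N = w @^-1` `]-oo, 0[); last first.
    by apply/seteqP; split => x /=; rewrite in_itv.
  by rewrite -(setTI (_ @^-1` _)); apply: mw.
have mwN : measurable_fun N (EFin \o w).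
  by apply: measurable_funTS; exact/measurable_EFinP.
have : (\int[mu]_(x in N) `|(EFin \o w) x| = 0)%E.
  apply/eqP; rewrite eq_le integral_ge0 ?andbT//.
  rewrite (eq_integral (fun x => - (w x)%:E)%E); last first.
    by move=> x; rewrite inE/= => /ltW wx; rewrite ler0_norm.
  rewrite integralN/=; last first.
    apply: fin_num_adde_defr; rewrite integral0_eq// => x Nx.
    by rewrite funeposE/= -EFin_max; congr EFin; apply/max_idPr/ltW.
  by rewrite -uw// oppe_le0 integral_ge0// => x _; rewrite lee_fin.
move/(ae_eq_integral_abs mu mN mwN); apply: filterS => x wx0.
rewrite leNgt; apply/negP => wx.
by have [w0] : (w x)%:E = 0%E := wx0 wx; move: wx; rewrite w0 ltxx.
Qed.

(** [w] is only almost everywhere nonnegative, so the change of variables is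
    applied to its positive part. *)
Lemma transfers_integral_ge0 (u w k : X -> R) : transfers u w -> (forall x, 0 <= u x) ->
  measurable_fun [set: X] k -> (forall x, 0 <= k x) ->
  integrable (fun x => u x * k (sigma x)) ->
  integrable (fun x => w x * k x) /\
  \int[mu]_x (u x * k (sigma x)) = \int[mu]_x (w x * k x).
Proof.
move=> uw u0 mk k0 iuk.
have wge0 := transfers_ge0 uw u0; case: uw => iu iw uw.
have mes_u : measurable_fun [set: X] u.
  by apply/measurable_EFinP; exact: measurable_int iu.
have mw : measurable_fun [set: X] w.
  by apply/measurable_EFinP; exact: measurable_int iw.
have mw' : measurable_fun [set: X] (w^\+)%R by exact: measurable_funrpos.
have ww' : (w^\+)%R = w %[ae mu].
  by apply: filterS wge0 => x w0 _; apply/max_idPl.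
have ww'E A : measurable A ->
    (\int[mu]_(x in A) (w x)%:E = \int[mu]_(x in A) ((w^\+)%R x)%:E)%E.
  move=> mA; apply: ae_eq_integral => //.
  - by apply: measurable_funTS; exact/measurable_EFinP.
  - by apply: measurable_funTS; exact/measurable_EFinP.
  - by apply: filterS ww' => x wx _ /=; rewrite wx.
have E := @ge0_integral_weight_transfer _ _ _ mu sigma u (w^\+)%R k
  measurable_sigma mes_u u0 mw' (funrpos_ge0 w) _ mk k0.
have {}E : (\int[mu]_x (u x * k (sigma x))%:E = \int[mu]_x ((w^\+)%R x * k x)%:E)%E.
  by apply: E => A mA; rewrite uw// ww'E.
have iwk' : integrable (fun x => (w^\+)%R x * k x).
  apply/integrableP; split.
    by apply/measurable_EFinP; exact: measurable_funM.
  under eq_integral do rewrite /= ger0_norm ?mulr_ge0 ?funrpos_ge0//.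
  rewrite -E; case/integrableP: iuk => _.
  by under eq_integral do rewrite /= ger0_norm ?mulr_ge0//.
have wk : (fun x => (w^\+)%R x * k x) = (fun x => w x * k x) %[ae mu].
  by apply: filterS ww' => x wx _ /=; rewrite wx.
have mwk : measurable_fun [set: X] (fun x => w x * k x) by exact: measurable_funM.
split; first exact: integrable_ae_eq wk iwk'.
rewrite -(Rintegral_ae_eq _ mwk wk) ?/Rintegral ?E//.
exact: measurable_funM.
Qed.

Hypothesis sigma_inv : measure_invariant mu sigma.

Lemma Sstar_real_transfers u : integrable u ->
  transfers u (Sstar_real mu sigma u).
Proof.
move=> iu; rewrite /Sstar_real; case: pselect => // iu'.
have dom : push_charge sigma iu' `<< mu.
  apply/null_content_dominatesP => A mA A0; rewrite /push_charge /pushforward.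
  apply: null_set_integral; first exact: measurable_preimage_sigma.
  - by apply: measurable_funTS; exact: measurable_int iu.
  - by move: (sigma_inv mA) => /= ->.
have RNE x : (fine (('d (push_charge sigma iu') '/d mu) x))%:E =
    ('d (push_charge sigma iu') '/d mu) x.
  by rewrite fineK// Radon_Nikodym_fin_num.
split => // [|A mA].
- rewrite (_ : _ \o _ = ('d (push_charge sigma iu') '/d mu)).
    exact: Radon_Nikodym_integrable.
  by apply/funext => x /=; rewrite RNE.
- under [RHS]eq_integral do rewrite /= RNE.
  by rewrite -Radon_Nikodym_integral.
Qed.

Lemma measurable_Sstar_real u : measurable_fun [set: X] (Sstar_real mu sigma u).
Proof.
have [iu|niu] := pselect (integrable u).
  by apply/measurable_EFinP; case: (Sstar_real_transfers iu) => _ /measurable_int.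
by rewrite /Sstar_real; case: pselect.
Qed.

(** The positive part of [w] need not transfer the positive part of [u], as
    mass can cancel inside the fibres of [sigma]. Instead, [|u|] and [u + |u|]
    are nonnegative and transferred by [W := Sstar_real |u|] and [w + W], and
    the two identities are subtracted; [k] is split into its positive and
    negative parts. *)
Lemma transfers_integral (u w k : X -> R) : transfers u w ->
  measurable_fun [set: X] k -> integrable (fun x => u x * k (sigma x)) ->
  integrable (fun x => w x * k x) /\
  \int[mu]_x (u x * k (sigma x)) = \int[mu]_x (w x * k x).
Proof.
move=> uw mk iuk.
have iu : integrable u by case: uw.
have mes_u : measurable_fun [set: X] u.
  by apply/measurable_EFinP; exact: measurable_int iu.
have iau : integrable (fun x => `|u x|) by exact: integrable_norm.
have aW := Sstar_real_transfers iau.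
set W := Sstar_real _ _ _ in aW.
have uaW := transfersD uw aW.
have pos (h : X -> R) : measurable_fun [set: X] h -> (forall x, 0 <= h x) ->
    (forall x, h x <= `|k x|) ->
    [/\ integrable (fun x => u x * h (sigma x)), integrable (fun x => w x * h x) &
      \int[mu]_x (u x * h (sigma x)) = \int[mu]_x (w x * h x)].
  move=> mh h0 hk.
  have mhs : measurable_fun [set: X] (h \o sigma) by exact: measurableT_comp.
  have iauh : integrable (fun x => `|u x| * h (sigma x)).
    apply: le_integrable iuk => //.
      by apply/measurable_EFinP; apply: measurable_funM => //; exact: measurableT_comp.
    move=> x _; rewrite /= lee_fin !normrM normr_id ler_wpM2l// ger0_norm//.
  have iuh : integrable (fun x => u x * h (sigma x)).
    apply: le_integrable iauh => //.
      by apply/measurable_EFinP; exact: measurable_funM.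
    by move=> x _; rewrite /= lee_fin !normrM normr_id.
  have [iWh Wh] := transfers_integral_ge0 aW (fun x => normr_ge0 _) mh h0 iauh.
  have iuah : integrable (fun x => (u x + `|u x|) * h (sigma x)).
    have := integrableD measurableT iuh iauh.
    by apply: eq_integrable => // x _; rewrite /= mulrDl.
  have ua0 x : 0 <= u x + `|u x| by rewrite -lerBlDl sub0r -normrN ler_norm.
  have [iwWh wWh] := transfers_integral_ge0 uaW ua0 mh h0 iuah.
  have wE x : w x * h x = (w x + W x) * h x - W x * h x by ring.
  have uE x : u x * h (sigma x) = (u x + `|u x|) * h (sigma x) - `|u x| * h (sigma x) by ring.
  split => //.
    have := integrableB measurableT iwWh iWh.
    by apply: eq_integrable => // x _; rewrite /= wE.
  under eq_Rintegral do rewrite uE.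
  under [RHS]eq_Rintegral do rewrite wE.
  by rewrite RintegralB// RintegralB//; congr (_ - _).
have mkp : measurable_fun [set: X] (k^\+)%R by exact: measurable_funrpos.
have mkn : measurable_fun [set: X] (k^\-)%R by exact: measurable_funrneg.
have [x|iup iwp Ep] := pos _ mkp (funrpos_ge0 k).
  by rewrite /funrpos ge_max ler_norm normr_ge0.
have [x|iun iwn En] := pos _ mkn (funrneg_ge0 k).
  by rewrite /funrneg ge_max normr_ge0 andbT -normrN ler_norm.
have kE x : k x = (k^\+)%R x - (k^\-)%R x by rewrite -{1}(funrposBneg k).
have wE x : w x * k x = w x * (k^\+)%R x - w x * (k^\-)%R x by rewrite kE mulrBr.
have uE x : u x * k (sigma x) =
  u x * (k^\+)%R (sigma x) - u x * (k^\-)%R (sigma x) by rewrite kE mulrBr.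
split.
  have := integrableB measurableT iwp iwn.
  by apply: eq_integrable => // x _; rewrite /= wE.
under eq_Rintegral do rewrite uE.
under [RHS]eq_Rintegral do rewrite wE.
by rewrite RintegralB// RintegralB// Ep En.
Qed.

End RealTransfer.

(** * Complex measurable and square integrable functions *)

Section ComplexFunctions.
Context (R : realType) (d : measure_display) (X : measurableType d).
Variable mu : probability X R.
Implicit Types f g h : X -> R[i].

Local Notation integrable f := (mu.-integrable [set: X] (EFin \o f)).
Local Notation L2 := (cLfun mu 2%:E).

Lemma sqr_normcE (z : R[i]) : normc z ^+ 2 = complex.Re z ^+ 2 + complex.Im z ^+ 2.
Proof. by case: z => a b /=; rewrite sqr_sqrtr// addr_ge0 ?sqr_ge0. Qed.

Lemma normc_ge0 (z : R[i]) : 0 <= normc z.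
Proof. by case: z => a b /=; exact: sqrtr_ge0. Qed.

Lemma normc_conj (z : R[i]) : normc (z^*) = normc z.
Proof. by case: z => a b /=; rewrite sqrrN. Qed.

(** Rewriting with the generic morphism law leaves the conjugation wrapped in
    its morphism structure, where the involution law no longer matches. *)
Lemma conj_mulc (z w : R[i]) : (z * w)^* = z^* * w^*.
Proof. exact: rmorphM. Qed.

Lemma conj_subc (z w : R[i]) : (z - w)^* = z^* - w^*.
Proof. exact: rmorphB. Qed.

Lemma normc_real (r : R) : normc r%:C = `|r|.
Proof. by rewrite /= expr0n addr0 sqrtr_sqr. Qed.

Lemma mulc_conj (z : R[i]) : z * z^* = (normc z ^+ 2)%:C.
Proof. by rewrite sqr_normcE; case: z => a b; simpc; congr (_ +i* _) => /=; ring. Qed.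

Lemma ler_Re_normc (z : R[i]) : `|complex.Re z| <= normc z.
Proof.
rewrite -(@ler_pXn2r _ 2)// ?nnegrE ?normc_ge0// sqr_normcE real_normK ?num_real//.
by rewrite lerDl sqr_ge0.
Qed.

Lemma ler_Im_normc (z : R[i]) : `|complex.Im z| <= normc z.
Proof.
rewrite -(@ler_pXn2r _ 2)// ?nnegrE ?normc_ge0// sqr_normcE real_normK ?num_real//.
by rewrite lerDr sqr_ge0.
Qed.

Lemma ler_normc_ReIm (z : R[i]) : normc z <= `|complex.Re z| + `|complex.Im z|.
Proof.
rewrite -(@ler_pXn2r _ 2)// ?nnegrE ?normc_ge0 ?addr_ge0// sqr_normcE sqrrD.
by rewrite !real_normK ?num_real// -addrAC lerDl mulrn_wge0// mulr_ge0.
Qed.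

Lemma sqr_normcB (z w : R[i]) : normc (z - w) ^+ 2 <= 2 * normc z ^+ 2 + 2 * normc w ^+ 2.
Proof.
case: z w => a b [a' b']; rewrite !sqr_normcE; simpc => /=.
by have := sqr_ge0 (a + a'); have := sqr_ge0 (b + b'); lra.
Qed.

Lemma normcM_le (z w : R[i]) : normc (z * w) <= normc z ^+ 2 + normc w ^+ 2.
Proof. by rewrite normcM; have := normc_ge0 z; have := normc_ge0 w; nra. Qed.

Lemma cmeasurableM f g : cmeasurable f -> cmeasurable g ->
  cmeasurable (fun x => f x * g x).
Proof.
move=> [fr fi] [gr gi]; split.
- rewrite (_ : (fun x => _) = (fun x => complex.Re (f x) * complex.Re (g x) -
    complex.Im (f x) * complex.Im (g x))).
    by apply: measurable_funB; exact: measurable_funM.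
  by apply/funext => x; case: (f x) (g x) => a b [].
- rewrite (_ : (fun x => _) = (fun x => complex.Re (f x) * complex.Im (g x) +
    complex.Im (f x) * complex.Re (g x))).
    by apply: measurable_funD; exact: measurable_funM.
  by apply/funext => x; case: (f x) (g x) => a b [].
Qed.

Lemma cmeasurableD f g : cmeasurable f -> cmeasurable g ->
  cmeasurable (fun x => f x + g x).
Proof.
move=> [fr fi] [gr gi]; split.
- rewrite (_ : (fun x => _) = (fun x => complex.Re (f x) + complex.Re (g x))).
    exact: measurable_funD.
  by apply/funext => x; case: (f x) (g x) => a b [].
- rewrite (_ : (fun x => _) = (fun x => complex.Im (f x) + complex.Im (g x))).
    exact: measurable_funD.
  by apply/funext => x; case: (f x) (g x) => a b [].
Qed.

Lemma cmeasurable_cst z : cmeasurable (cst z : X -> R[i]).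
Proof. by split; exact: measurable_cst. Qed.

Lemma cmeasurable_conj f : cmeasurable f -> cmeasurable (fun x => (f x)^*).
Proof.
move=> [fr fi]; split.
- by rewrite (_ : (fun x => _) = (fun x => complex.Re (f x)))//;
    apply/funext => x; case: (f x).
- rewrite (_ : (fun x => _) = (fun x => - complex.Im (f x))).
    exact: measurableT_comp.
  by apply/funext => x; case: (f x).
Qed.

Lemma cmeasurableB f g : cmeasurable f -> cmeasurable g ->
  cmeasurable (fun x => f x - g x).
Proof.
move=> mf mg; rewrite (_ : (fun x => _) = (fun x => f x + (cst (-1) x) * g x)).
  by apply: cmeasurableD => //; apply: cmeasurableM => //; exact: cmeasurable_cst.
by apply/funext => x /=; rewrite mulN1r.
Qed.

Lemma cmeasurable_sum (I : Type) (r : seq I) (F : I -> X -> R[i]) :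
  (forall i, cmeasurable (F i)) -> cmeasurable (fun x => \sum_(i <- r) F i x).
Proof.
move=> mF; elim: r => [|i r IH].
  by under eq_fun do rewrite big_nil; exact: cmeasurable_cst.
by under eq_fun do rewrite big_cons; exact: cmeasurableD.
Qed.

Lemma cmeasurable_comp f (phi : X -> X) : measurable_fun [set: X] phi ->
  cmeasurable f -> cmeasurable (f \o phi).
Proof. by move=> mphi [fr fi]; split; [exact: measurableT_comp fr mphi|exact: measurableT_comp fi mphi]. Qed.

Lemma measurable_cabs f : cmeasurable f -> measurable_fun [set: X] (cabs f).
Proof.
move=> [fr fi]; rewrite (_ : cabs f = Num.sqrt \o
    (fun x => complex.Re (f x) ^+ 2 + complex.Im (f x) ^+ 2)).
  apply: measurableT_comp.
    apply: continuous_measurable_fun; exact: sqrt_continuous.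
  by apply: measurable_funD; exact: measurable_funX.
by apply/funext => x; rewrite /cabs /=; case: (f x).
Qed.

Lemma measurable_sqr_normc f : cmeasurable f ->
  measurable_fun [set: X] (fun x => normc (f x) ^+ 2).
Proof. by move=> mf; apply: measurable_funX; exact: measurable_cabs. Qed.

Definition cintegrable f : Prop :=
  integrable (fun x => complex.Re (f x)) /\ integrable (fun x => complex.Im (f x)).

Lemma cintegrable_measurable f : cintegrable f -> cmeasurable f.
Proof. by move=> [ir ii]; split; apply/measurable_EFinP; [exact: measurable_int ir|exact: measurable_int ii]. Qed.

Lemma cintegrable_cabs f : cintegrable f -> integrable (cabs f).
Proof.
move=> fi; have mf := measurable_cabs (cintegrable_measurable fi).
case: fi => ir ii.
have := integrableD measurableT (integrable_norm ir) (integrable_norm ii).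
apply: le_integrable => //; first exact/measurable_EFinP.
move=> x _; rewrite /= lee_fin (ger0_norm (normc_ge0 _)).
by rewrite ger0_norm ?addr_ge0// ler_normc_ReIm.
Qed.

Lemma le_cintegrable f (b : X -> R) : cmeasurable f -> integrable b ->
  (forall x, normc (f x) <= b x) -> cintegrable f.
Proof.
move=> [fr fi] ib fb; split.
- apply: le_integrable ib => //; first exact/measurable_EFinP.
  move=> x _; rewrite /= lee_fin (le_trans (ler_Re_normc _))//.
  exact: le_trans (fb x) (ler_norm _).
- apply: le_integrable ib => //; first exact/measurable_EFinP.
  move=> x _; rewrite /= lee_fin (le_trans (ler_Im_normc _))//.
  exact: le_trans (fb x) (ler_norm _).
Qed.

Lemma L2P f : L2 f <-> cmeasurable f /\ integrable (fun x => normc (f x) ^+ 2).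
Proof.
split=> [[mf f2]|[mf f2]]; split=> //; first exact: Lfun2_integrable_sqr f2.
rewrite inE; apply/andP; split; rewrite inE/=; first exact: measurable_cabs.
rewrite /finite_norm unlock poweR_lty//.
case/integrableP: f2 => _; apply: le_lt_trans.
rewrite le_eqVlt; apply/orP; left; apply/eqP; apply: eq_integral => x _ /=.
by rewrite powR_mulrn// normrX.
Qed.

Lemma eq_norm2 f g :
  (\int[mu]_x (normc (f x) ^+ 2)%:E = \int[mu]_x (normc (g x) ^+ 2)%:E)%E ->
  cLnorm mu 2%:E f = cLnorm mu 2%:E g.
Proof.
move=> fg; rewrite /cLnorm unlock; congr (fine (_ `^ _)).
have E h : (\int[mu]_x (`|(EFin \o cabs h) x| `^ 2) =
    \int[mu]_x (normc (h x) ^+ 2)%:E)%E.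
  apply: eq_integral => x _ /=.
  by rewrite powR_mulrn// real_normK ?num_real.
by rewrite !E.
Qed.

Lemma norm2_0 : cLnorm mu 2%:E (cst 0) = 0.
Proof.
rewrite /cLnorm (_ : EFin \o _ = cst 0%E) ?Lnorm0//.
by apply/funext => x /=; rewrite /cabs /= expr0n addr0 sqrtr0.
Qed.

Lemma eq_norm2_ae f g : cmeasurable f -> cmeasurable g -> f = g %[ae mu] ->
  cLnorm mu 2%:E f = cLnorm mu 2%:E g.
Proof.
move=> mf mg fg; apply: eq_norm2; apply: ge0_ae_eq_integral => //.
- by apply/measurable_EFinP; exact: measurable_sqr_normc.
- by apply/measurable_EFinP; exact: measurable_sqr_normc.
- by move=> x _; rewrite lee_fin sqr_ge0.
- by move=> x _; rewrite lee_fin sqr_ge0.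
- by apply: filterS fg => x fgx _; rewrite fgx.
Qed.

Lemma L2_mul_conj f g : L2 f -> L2 g -> cintegrable (fun x => f x * (g x)^*).
Proof.
move=> /L2P[mf f2] /L2P[mg g2].
apply: (@le_cintegrable _ (fun x => normc (f x) ^+ 2 + normc (g x) ^+ 2)).
- by apply: cmeasurableM => //; exact: cmeasurable_conj.
- exact: integrableD f2 g2.
- by move=> x; rewrite -[normc (g x)]normc_conj normcM_le.
Qed.

Lemma L2B f g : L2 f -> L2 g -> L2 (fun x => f x - g x).
Proof.
move=> /L2P[mf f2] /L2P[mg g2]; apply/L2P; split; first exact: cmeasurableB.
have := integrableD measurableT (integrableZl measurableT 2 f2)
  (integrableZl measurableT 2 g2).
apply: le_integrable => //.
  by apply/measurable_EFinP/measurable_sqr_normc; exact: cmeasurableB.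
move=> x _; rewrite /= lee_fin ger0_norm ?sqr_ge0//.
exact: le_trans (sqr_normcB _ _) (ler_norm _).
Qed.

Lemma cintegralB f g : cintegrable f -> cintegrable g ->
  cintegral mu (fun x => f x - g x) = cintegral mu f - cintegral mu g.
Proof.
move=> [fr fi] [gr gi]; rewrite /cintegral; simpc; congr (_ +i* _).
- by rewrite -RintegralB//; apply: eq_Rintegral => x _; case: (f x) (g x) => a b [].
- by rewrite -RintegralB//; apply: eq_Rintegral => x _; case: (f x) (g x) => a b [].
Qed.

Lemma cintegral_conj f : cintegrable f ->
  cintegral mu (fun x => (f x)^*) = (cintegral mu f)^*.
Proof.
move=> [_ fi]; rewrite /cintegral /=; congr (_ +i* _).
  by apply: eq_Rintegral => x _; case: (f x).
rewrite -mulN1r -RintegralZl//; apply: eq_Rintegral => x _.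
by rewrite mulN1r; case: (f x).
Qed.

Lemma inner_self_eq0 h : L2 h -> inner mu h h = 0 -> h = cst 0 %[ae mu].
Proof.
move=> /L2P[mh h2] [hh0 _].
have mh2 : measurable_fun [set: X] (EFin \o fun x => normc (h x) ^+ 2).
  by apply/measurable_EFinP; exact: measurable_sqr_normc.
have /(ae_eq_integral_abs mu measurableT mh2) : (\int[mu]_x
    `|(EFin \o (fun x => normc (h x) ^+ 2)%R) x| = 0)%E.
  under eq_integral do rewrite /= ger0_norm ?sqr_ge0//.
  rewrite -[LHS]fineK ?integrable_fin_num//; congr EFin; rewrite -[RHS]hh0.
  by apply: eq_Rintegral => x _; rewrite mulc_conj.
apply: filterS => x /(_ I) hx0 _; apply: eq0_normc; apply/eqP.
by rewrite -sqrf_eq0; apply/eqP; case: hx0.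
Qed.

End ComplexFunctions.

(** * The filter operator and its adjoint *)

Section FilterOperator.
Context (R : realType) (d : measure_display) (X : measurableType d).
Variables (mu : probability X R) (sigma : {mfun X >-> X}).
Hypothesis sigma_inv : measure_invariant mu sigma.
Implicit Types f g h : X -> R[i].

Local Notation integrable f := (mu.-integrable [set: X] (EFin \o f)).
Local Notation L2 := (cLfun mu 2%:E).

Let measurable_sigma : measurable_fun [set: X] sigma.
Proof. exact: measurable_funPT. Qed.

Lemma cmeasurable_Sstar g : cmeasurable (Sstar mu sigma g).
Proof. by split; exact: measurable_Sstar_real. Qed.

Lemma ae_eq_comp_sigma (T : Type) (f g : X -> T) :
  f = g %[ae mu] -> f \o sigma = g \o sigma %[ae mu].
Proof.
move=> [N [mN N0 fgN]]; exists (sigma @^-1` N); split.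
- by rewrite -(setTI (_ @^-1` _)); exact: measurable_sigma.
- by rewrite -N0; apply: sigma_inv.
- by move=> x /= fgx; apply: fgN => /= E; apply: fgx => _; exact: E.
Qed.

(** The integrability of [u * (k \o sigma)] gives that of the four products of
    real and imaginary parts, as these are bounded by the modulus. *)
Lemma Sstar_integral u k : cintegrable mu u -> cmeasurable k ->
  cintegrable mu (fun x => u x * k (sigma x)) ->
  cintegral mu (fun x => u x * k (sigma x)) =
    cintegral mu (fun x => Sstar mu sigma u x * k x).
Proof.
move=> [ur ui] mk iuk; have iauk := cintegrable_cabs iuk.
have tr (p q : R[i] -> R) :
    measurable_fun [set: X] (fun x => q (k x)) ->
    integrable (fun x => p (u x)) ->
    (forall z, `|p z| <= normc z) -> (forall z, `|q z| <= normc z) ->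
    [/\ integrable (fun x => p (u x) * q (k (sigma x))),
        integrable (fun x => Sstar_real mu sigma (fun y => p (u y)) x * q (k x)) &
        \int[mu]_x (p (u x) * q (k (sigma x))) =
        \int[mu]_x (Sstar_real mu sigma (fun y => p (u y)) x * q (k x))].
  move=> mq ip pn qn.
  have ipq : integrable (fun x => p (u x) * q (k (sigma x))).
    apply: le_integrable iauk => //.
      apply/measurable_EFinP; apply: measurable_funM.
        by apply/measurable_EFinP; exact: measurable_int ip.
      exact: (measurableT_comp mq measurable_sigma).
    move=> x _; rewrite /= lee_fin /cabs (ger0_norm (normc_ge0 _)) normcM normrM.
    exact: ler_pM.
  by have [] := transfers_integral sigma_inv (Sstar_real_transfers sigma_inv ip) mq ipq.
have [mkr mki] := mk.
have [i1 j1 e1] := tr (@complex.Re R) (@complex.Re R) mkr ur (@ler_Re_normc R) (@ler_Re_normc R).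
have [i2 j2 e2] := tr (@complex.Im R) (@complex.Im R) mki ui (@ler_Im_normc R) (@ler_Im_normc R).
have [i3 j3 e3] := tr (@complex.Re R) (@complex.Im R) mki ur (@ler_Re_normc R) (@ler_Im_normc R).
have [i4 j4 e4] := tr (@complex.Im R) (@complex.Re R) mkr ui (@ler_Im_normc R) (@ler_Re_normc R).
have ReM (z w : R[i]) : complex.Re (z * w) =
    complex.Re z * complex.Re w - complex.Im z * complex.Im w.
  by case: z w => a b [].
have ImM (z w : R[i]) : complex.Im (z * w) =
    complex.Re z * complex.Im w + complex.Im z * complex.Re w.
  by case: z w => a b [].
rewrite /cintegral; congr (_ +i* _).
- under eq_Rintegral do rewrite ReM.
  under [RHS]eq_Rintegral do rewrite ReM.
  by rewrite RintegralB// RintegralB//= e1 e2.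
- under eq_Rintegral do rewrite ImM.
  under [RHS]eq_Rintegral do rewrite ImM.
  by rewrite RintegralD// RintegralD//= e3 e4.
Qed.

Variable m : X -> R[i].
Hypothesis L2m : L2 m.
Hypothesis m_norm : Sstar mu sigma (fun x => (normc (m x) ^+ 2)%:C) = cst 1 %[ae mu].

Local Notation S := (filter_op sigma m).

(** The normalization says that the weight [|m|^2] is transferred to the
    constant weight [1]. *)
Lemma filter_op_integral f : cmeasurable f ->
  (\int[mu]_x (normc (S f x) ^+ 2)%:E = \int[mu]_x (normc (f x) ^+ 2)%:E)%E.
Proof.
move=> mf; have [mm im] := (L2P mu m).1 L2m.
have [_ iw mw] := Sstar_real_transfers sigma_inv im.
have w1 : Sstar_real mu sigma (fun x => normc (m x) ^+ 2) = cst 1 %[ae mu].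
  by apply: filterS m_norm => x /[apply] -[].
under eq_integral do rewrite /filter_op normcM exprMn.
rewrite (@ge0_integral_weight_transfer _ _ _ mu sigma
  (fun x => normc (m x) ^+ 2) (cst 1) (fun x => normc (f x) ^+ 2))//.
- by apply: eq_integral => x _; rewrite mul1r.
- exact: measurable_sqr_normc.
- by move=> x; exact: sqr_ge0.
- move=> A mA; rewrite mw//; apply: ae_eq_integral => //.
  - by apply: measurable_funTS; exact: measurable_int iw.
  - by apply/measurable_EFinP; exact: measurable_cst.
  - by apply: filterS w1 => x w1x _ /=; rewrite w1x.
- exact: measurable_sqr_normc.
- by move=> x; exact: sqr_ge0.
Qed.

Lemma L2_filter_op f : L2 f -> L2 (S f).
Proof.
move=> /L2P[mf f2]; have [mm _] := (L2P mu m).1 L2m.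
have mS : cmeasurable (S f) by exact/cmeasurableM/cmeasurable_comp.
apply/L2P; split=> //; apply/integrableP; split.
  by apply/measurable_EFinP; exact: measurable_sqr_normc.
under eq_integral do rewrite /= ger0_norm ?sqr_ge0//.
rewrite filter_op_integral//; case/integrableP: f2 => _.
by under eq_integral do rewrite /= ger0_norm ?sqr_ge0//.
Qed.

Lemma filter_op_isometry : L2_isometry mu S.
Proof.
split; last by move=> f [mf _]; apply: eq_norm2; exact: filter_op_integral.
split=> [f|f g _ _ fg|a f g _ _]; first exact: L2_filter_op.
- by apply: filterS (ae_eq_comp_sigma fg) => x /= /(_ I) E _; rewrite /filter_op E.
- by apply: aeW => x _; rewrite /filter_op mulrDr mulrCA.
Qed.

(** The formula for the adjoint of the filter operator. *)
Definition coeff g : X -> R[i] := Sstar mu sigma (fun x => (m x)^* * g x).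

Let cintegrable_conj_mul g : L2 g -> cintegrable mu (fun x => (m x)^* * g x).
Proof. by move=> g2; under eq_fun do rewrite mulrC; exact: L2_mul_conj. Qed.

(** Boundedness of the adjoint formula, by duality with the isometry [S]. The
    test function [k], the conjugate of [h] cut off where [|h| > n], is
    bounded, so that the change of variables applies before [h] is known to be
    square integrable. *)
Lemma L2_coeff g : L2 g -> L2 (coeff g).
Proof.
move=> L2g; have [mm im] := (L2P mu m).1 L2m; have [mg ig] := (L2P mu g).1 L2g.
set h := coeff g; have mh : cmeasurable h by exact: cmeasurable_Sstar.
have mh2 : measurable_fun [set: X] (fun x => (normc (h x) ^+ 2)%:E).
  by apply/measurable_EFinP; exact: measurable_sqr_normc.
pose A n := [set x | cabs h x <= n%:R].
have mA n : measurable (A n).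
  rewrite (_ : A n = cabs h @^-1` `]-oo, n%:R]); last first.
    by apply/seteqP; split => x /=; rewrite in_itv.
  by rewrite -(setTI (_ @^-1` _)); apply: (measurable_cabs mh).
have bound n : (\int[mu]_(x in A n) (normc (h x) ^+ 2)%:E <=
    \int[mu]_x (normc (g x) ^+ 2)%:E)%E.
  pose k x := (h x)^* * (\1_(A n) x)%:C.
  have mk : cmeasurable k.
    apply: cmeasurableM; first exact: cmeasurable_conj.
    by split=> /=; [exact: measurable_indic|exact: measurable_cst].
  have kE x : normc (k x) = normc (h x) * \1_(A n) x.
    by rewrite /k normcM normc_conj normc_real ger0_norm.
  have hkE x : h x * k x = (normc (k x) ^+ 2)%:C.
    rewrite kE /k mulrA mulc_conj exprMn indicE; case: (x \in A n).
      by rewrite expr1n mulr1 /= mulr1.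
    by rewrite mulr0 expr0n /= mulr0.
  have kn x : normc (k x) <= n%:R.
    rewrite kE indicE; case: (boolP (x \in A n)) => [|_]; last by rewrite mulr0.
    by rewrite inE /A/= mulr1.
  have mk2 := measurable_sqr_normc mk.
  have ik2 : integrable (fun x => normc (k x) ^+ 2).
    have : integrable (cst (n%:R ^+ 2)) by exact: finite_measure_integrable_cst.
    apply: le_integrable => //; first exact/measurable_EFinP.
    move=> x _; change (`|normc (k x) ^+ 2|%:E <= `|n%:R ^+ 2|%:E)%E.
    by rewrite lee_fin !ger0_norm ?sqr_ge0// ler_pXn2r ?nnegrE ?normc_ge0.
  have iu := cintegrable_conj_mul L2g.
  have iuk : cintegrable mu (fun x => (m x)^* * g x * k (sigma x)).
    apply: (@le_cintegrable _ _ _ _ _ (fun x => n%:R * cabs (fun x => (m x)^* * g x) x)).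
    - apply: cmeasurableM; first exact: cintegrable_measurable iu.
      exact: cmeasurable_comp.
    - by have := integrableZl measurableT n%:R (cintegrable_cabs iu).
    - by move=> x; rewrite normcM mulrC ler_wpM2r ?normc_ge0.
  have L2k : L2 k by exact/L2P.
  have [_ iSk] := (L2P mu _).1 (L2_filter_op L2k).
  have Ek : \int[mu]_x (normc (S k x) ^+ 2) = \int[mu]_x (normc (k x) ^+ 2).
    by rewrite /Rintegral filter_op_integral.
  have IkE : \int[mu]_x (normc (k x) ^+ 2) =
      \int[mu]_x complex.Re ((m x)^* * g x * k (sigma x)).
    have -> : \int[mu]_x complex.Re ((m x)^* * g x * k (sigma x)) =
        \int[mu]_x complex.Re (h x * k x).
      exact: (congr1 (@complex.Re R) (Sstar_integral iu mk iuk)).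
    by apply: eq_Rintegral => x _; rewrite hkE.
  have key : \int[mu]_x (normc (k x) ^+ 2) <= \int[mu]_x (normc (g x) ^+ 2).
    have iSg : integrable (fun x => normc (S k x) ^+ 2 + normc (g x) ^+ 2).
      by have := integrableD measurableT iSk ig.
    (* [2ab <= a^2 + b^2] with [a = |m * (k \o sigma)|] and [b = |g|]; since
       [a] and [k] have the same norm, the cut-off norm is absorbed on the
       left. *)
    have le2 : 2 * \int[mu]_x complex.Re ((m x)^* * g x * k (sigma x)) <=
        \int[mu]_x (normc (S k x) ^+ 2 + normc (g x) ^+ 2).
      rewrite -RintegralZl//; last by case: iuk.
      apply: le_Rintegral => //.
        by have := integrableZl measurableT 2 iuk.1.
      move=> x _; apply: le_trans (_ : 2 * (normc (S k x) * normc (g x)) <= _).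
        rewrite ler_pM2l//; apply: le_trans (ler_norm _) _.
        apply: le_trans (ler_Re_normc _) _.
        by rewrite /filter_op !normcM normc_conj mulrAC.
      by have := sqr_ge0 (normc (S k x) - normc (g x)); lra.
    by move: le2; rewrite -IkE RintegralD// Ek; lra.
  have -> : (\int[mu]_(x in A n) (normc (h x) ^+ 2)%:E =
      \int[mu]_x (normc (k x) ^+ 2)%:E)%E.
    rewrite integral_mkcond; apply: eq_integral => x _.
    rewrite patchE kE indicE; case: (x \in A n); first by rewrite mulr1.
    by rewrite mulr0 expr0n.
  by rewrite -[leLHS]fineK ?integrable_fin_num// -[leRHS]fineK ?integrable_fin_num//.
apply/L2P; split=> //; apply/integrableP; split=> //.
under eq_integral do rewrite /= ger0_norm ?sqr_ge0//.
apply: (@le_lt_trans _ _ (\int[mu]_x (normc (g x) ^+ 2)%:E)%E); last first.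
  case/integrableP: ig => _.
  by under eq_integral do rewrite /= ger0_norm ?sqr_ge0//.
(* The cut-off sets exhaust the space. *)
have AT : \bigcup_n A n = [set: X].
  apply/seteqP; split=> // x _; exists (Num.truncn (cabs h x)).+1 => //=.
  exact/ltW/truncnS_gt.
have nA : nondecreasing_seq A.
  move=> a b ab; apply/subsetPset => x /= hx; apply: (le_trans hx).
  by rewrite ler_nat.
have := @ge0_nondecreasing_set_cvg_integral _ _ _ A
  (fun x => (normc (h x) ^+ 2)%:E) mu nA mA (fun i => measurable_funTS mh2)
  (fun i x _ => sqr_ge0 _).
rewrite AT => hcvg; rewrite -(cvg_lim _ hcvg)//.
by apply: lime_le; [apply/cvg_ex; eexists; exact: hcvg|exact: nearW].
Qed.

Lemma inner_filter_op f g : L2 f -> L2 g ->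
  inner mu (S f) g = inner mu f (coeff g).
Proof.
move=> L2f L2g; rewrite /inner.
have iSg : cintegrable mu (fun x => (m x)^* * g x * (f (sigma x))^*).
  have := L2_mul_conj L2g (L2_filter_op L2f).
  rewrite (_ : (fun x => _) = (fun x => (m x)^* * g x * (f (sigma x))^*))//.
  by apply/funext => x; rewrite /filter_op conj_mulc mulrA [g x * _]mulrC.
have [mf _] := L2f.
have ihf := L2_mul_conj (L2_coeff L2g) L2f.
have E := Sstar_integral (cintegrable_conj_mul L2g) (cmeasurable_conj mf) iSg.
transitivity ((cintegral mu (fun x => (m x)^* * g x * (f (sigma x))^*))^*).
  rewrite -cintegral_conj//; congr cintegral; apply/funext => x.
  by rewrite /filter_op !conj_mulc !conjCK mulrAC.
rewrite E -cintegral_conj//; congr cintegral; apply/funext => x.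
by rewrite conj_mulc conjCK mulrC.
Qed.

(** The inner product determines a vector of [L^2] up to null sets: the
    difference of two candidates is orthogonal to itself. *)
Lemma adjoint_filter_op g : L2 g ->
  L2 (adjoint mu S g) /\ adjoint mu S g = coeff g %[ae mu].
Proof.
move=> L2g; have L2h := L2_coeff L2g.
have [L2a adjP] : L2 (adjoint mu S g) /\
    forall f, L2 f -> inner mu (S f) g = inner mu f (adjoint mu S g).
  have := @xgetPex _ (cst 0) [set h | L2 h /\
    forall f, L2 f -> inner mu (S f) g = inner mu f h].
  by apply; exists (coeff g); split=> // f L2f; exact: inner_filter_op.
split=> //; have L2ah := L2B L2a L2h.
have /(inner_self_eq0 L2ah) : inner mu (fun x => adjoint mu S g x - coeff g x)
    (fun x => adjoint mu S g x - coeff g x) = 0.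
  rewrite /inner.
  under eq_fun do rewrite conj_subc mulrBr.
  rewrite cintegralB; [|exact: L2_mul_conj..].
  by apply/eqP; rewrite subr_eq0 -/(inner mu _ _) -adjP// inner_filter_op.
by apply: filterS => x /= /[apply] /eqP; rewrite subr_eq0 => /eqP.
Qed.

Lemma L2_TTadj f : L2 f -> L2 (TTadj mu S f).
Proof. by move=> L2f; apply: L2_filter_op; case: (adjoint_filter_op L2f). Qed.

Lemma TTadj_filter_op f : L2 f -> TTadj mu S f =
  (fun x => m x * Esigma mu sigma (fun y => (m y)^* * f y) x) %[ae mu].
Proof.
move=> L2f; have [_ aE] := adjoint_filter_op L2f.
apply: filterS (ae_eq_comp_sigma aE) => x /= /(_ I) E _.
by rewrite /TTadj /filter_op E.
Qed.

Lemma L2_mul_Esigma f : L2 f ->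
  L2 (fun x => m x * Esigma mu sigma (fun y => (m y)^* * f y) x).
Proof. by move=> L2f; exact: (L2_filter_op (L2_coeff L2f)). Qed.

End FilterOperator.

(** * Cyclic vectors and orthogonality of the ranges *)

Section CyclicVectors.
Context (R : realType) (d : measure_display) (X : measurableType d).
Variables (mu : probability X R) (sigma : {mfun X >-> X}).
Hypothesis sigma_inv : measure_invariant mu sigma.
Implicit Types f g m u v : X -> R[i].

Local Notation L2 := (cLfun mu 2%:E).

Let measurable_sigma : measurable_fun [set: X] sigma.
Proof. exact: measurable_funPT. Qed.

Let measurable_preimage_sigma A : measurable A -> measurable (sigma @^-1` A).
Proof. by move=> mA; rewrite -(setTI (_ @^-1` _)); exact: measurable_sigma. Qed.

(** The hypothesis says that the image under [sigma] of the measure with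
    density [u] vanishes on every set. *)
Lemma Sstar_ae0 u : cintegrable mu u ->
  (forall A, measurable A ->
    cintegral mu (fun x => (\1_(sigma @^-1` A) x)%:C * u x) = 0) ->
  Sstar mu sigma u = cst 0 %[ae mu].
Proof.
move=> [ur ui] u0.
have real0 (p : X -> R) : mu.-integrable [set: X] (EFin \o p) ->
    (forall A, measurable A -> \int[mu]_(x in sigma @^-1` A) p x = 0) ->
    Sstar_real mu sigma p = cst 0 %[ae mu].
  move=> ip p0; have [_ iw pw] := Sstar_real_transfers sigma_inv ip.
  have E : ae_eq mu setT (EFin \o Sstar_real mu sigma p) (cst 0%E).
    apply: integral_ae_eq => // A _ mA; rewrite integral0 -pw//.
    rewrite -[LHS]fineK; first by congr EFin; exact: p0.
    apply: integrable_fin_num; first exact: measurable_preimage_sigma.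
    apply: integrableS ip => //; exact: measurable_preimage_sigma.
  by apply: filterS E => x /[apply] -[].
have restr (p : R[i] -> R) A x : p 0 = 0 ->
    p ((\1_A x)%:C * u x) = ((fun y => p (u y)) \_ A) x.
  move=> p0; rewrite patchE indicE; case: (x \in A); first by rewrite mul1r.
  by rewrite mul0r.
have r0 : Sstar_real mu sigma (fun x => complex.Re (u x)) = cst 0 %[ae mu].
  apply: real0 => // A /u0[E _]; rewrite -[RHS]E Rintegral_mkcond.
  by apply: eq_Rintegral => x _; rewrite (restr (@complex.Re R)).
have i0 : Sstar_real mu sigma (fun x => complex.Im (u x)) = cst 0 %[ae mu].
  apply: real0 => // A /u0[_ E]; rewrite -[RHS]E Rintegral_mkcond.
  by apply: eq_Rintegral => x _; rewrite (restr (@complex.Im R)).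
by apply: filterS2 r0 i0 => x rx ix xT; rewrite /Sstar rx// ix.
Qed.

Lemma cyclic_subspace_indic m A : L2 m -> measurable A ->
  cyclic_subspace mu sigma m (fun x => (\1_(sigma @^-1` A) x)%:C * m x).
Proof.
move=> L2m mA; have mA' := measurable_preimage_sigma mA.
have mg : cmeasurable (fun x : X => (\1_(sigma @^-1` A) x)%:C : R[i]).
  by split=> /=; [exact: measurable_indic|exact: measurable_cst].
have g1 x : normc ((\1_(sigma @^-1` A) x)%:C : R[i]) <= 1.
  by rewrite normc_real ger0_norm// indicE; case: (_ \in _).
have [mm im] := (L2P mu m).1 L2m.
have mgm := cmeasurableM mg mm.
split=> [|e e0].
  apply/L2P; split=> //; apply: le_integrable im => //.
    by apply/measurable_EFinP; exact: measurable_sqr_normc.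
  move=> x _.
  change (`|normc ((\1_(sigma @^-1` A) x)%:C * m x) ^+ 2|%:E <= `|normc (m x) ^+ 2|%:E)%E.
  rewrite lee_fin !ger0_norm ?sqr_ge0// ler_pXn2r ?nnegrE ?normc_ge0//.
  by rewrite normcM ler_piMl ?normc_ge0.
exists (fun x => (\1_(sigma @^-1` A) x)%:C); last first.
  rewrite (_ : (fun x => _) = cst 0) ?norm2_0//.
  by apply/funext => x; rewrite subrr.
split=> [B mB|B mB|].
- exists (\1_A @^-1` B); last by rewrite setTI.
  by rewrite -(setTI (_ @^-1` _)); apply: (measurable_indic mA).
- exists ((cst 0 : X -> R) @^-1` B); last by rewrite setTI.
  have m0 : measurable_fun [set: X] (cst 0 : X -> R) by exact: measurable_cst.
  by rewrite -(setTI (_ @^-1` _)); exact: m0.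
- split=> //; rewrite inE; apply/andP; split; rewrite inE/=.
    exact: measurable_cabs.
  rewrite /finite_norm unlock; case: ifPn => // _.
  apply: (@le_lt_trans _ _ 1%E); last exact: ltry.
  apply/ess_supP; apply: aeW => x.
  change (`|normc ((\1_(sigma @^-1` A) x)%:C : R[i])|%:E <= 1)%E.
  by rewrite lee_fin ger0_norm ?normc_ge0.
Qed.

(** The orthogonality is tested on [1_(sigma^-1 A) * m] and on [m'], the
    latter being the case [A = X] of the former. *)
Lemma cyclic_orthogonal_Sstar m m' : L2 m -> L2 m' ->
  (forall f g, cyclic_subspace mu sigma m f -> cyclic_subspace mu sigma m' g ->
    inner mu f g = 0) ->
  Sstar mu sigma (fun x => m x * (m' x)^*) = cst 0 %[ae mu].
Proof.
move=> L2m L2m' orth; apply: Sstar_ae0 => [|A mA]; first exact: L2_mul_conj.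
have cm' : cyclic_subspace mu sigma m' m'.
  have := cyclic_subspace_indic L2m' measurableT.
  rewrite preimage_setT indicT; congr cyclic_subspace.
  by apply/funext => x; exact: mul1r.
rewrite -(orth _ _ (cyclic_subspace_indic L2m mA) cm') /inner.
by congr cintegral; apply/funext => x; rewrite mulrA.
Qed.

Lemma cintegral_ae0 f : cmeasurable f -> f = cst 0 %[ae mu] ->
  cintegral mu f = 0.
Proof.
move=> [fr fi] f0; rewrite /cintegral.
rewrite (@Rintegral_ae_eq _ _ _ _ _ (cst 0))//; last first.
  by apply: filterS f0 => x /[apply] ->.
rewrite [X in _ +i* X](@Rintegral_ae_eq _ _ _ _ _ (cst 0))//; last first.
  by apply: filterS f0 => x /[apply] ->.
by rewrite Rintegral_cst// mul0r.
Qed.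

Section TwoFilters.
Variables m m' : X -> R[i].
Hypotheses (L2m : L2 m) (L2m' : L2 m').
Hypothesis m_norm :
  Sstar mu sigma (fun x => (normc (m x) ^+ 2)%:C) = cst 1 %[ae mu].
Hypothesis m'_norm :
  Sstar mu sigma (fun x => (normc (m' x) ^+ 2)%:C) = cst 1 %[ae mu].
Hypothesis mm'0 : Sstar mu sigma (fun x => m x * (m' x)^*) = cst 0 %[ae mu].

Lemma inner_filter_op_orthogonal f g : L2 f -> L2 g ->
  inner mu (filter_op sigma m f) (filter_op sigma m' g) = 0.
Proof.
move=> L2f L2g; pose k x := f x * (g x)^*.
have mk : cmeasurable k := cintegrable_measurable (L2_mul_conj L2f L2g).
have E : (fun x => filter_op sigma m f x * (filter_op sigma m' g x)^*) =
    (fun x => m x * (m' x)^* * k (sigma x)).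
  by apply/funext => x; rewrite /filter_op /k conj_mulc mulrACA.
rewrite /inner E Sstar_integral//; first last.
- rewrite -E; apply: L2_mul_conj; exact: L2_filter_op.
- exact: L2_mul_conj.
apply: cintegral_ae0; first by apply: cmeasurableM => //; exact: cmeasurable_Sstar.
by apply: filterS mm'0 => x /[apply] ->; rewrite mul0r.
Qed.

(** The vector [c := S_m^* v], for [v] in the range of [S_m'], has
    [<c, c> = <S_m c, v> = 0]. *)
Lemma TTadj_orthogonal f : L2 f ->
  TTadj mu (filter_op sigma m) (TTadj mu (filter_op sigma m') f) = cst 0 %[ae mu].
Proof.
move=> L2f; have [L2a _] := adjoint_filter_op sigma_inv L2m' m'_norm L2f.
have L2v : L2 (TTadj mu (filter_op sigma m') f) by exact: L2_filter_op.
set v := TTadj _ (filter_op sigma m') f in L2v *.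
have [L2b bc] := adjoint_filter_op sigma_inv L2m m_norm L2v.
have L2c := L2_coeff sigma_inv L2m m_norm L2v.
have c0 : coeff mu sigma m v = cst 0 %[ae mu].
  apply: (inner_self_eq0 L2c).
  by rewrite -inner_filter_op// inner_filter_op_orthogonal.
have b0 : adjoint mu (filter_op sigma m) v = cst 0 %[ae mu].
  by apply: filterS2 bc c0 => x bx cx xT; rewrite bx// cx.
apply: filterS (ae_eq_comp_sigma sigma_inv b0) => x /[apply] /= E.
by rewrite /TTadj /filter_op E mulr0.
Qed.

End TwoFilters.

Lemma L2_has_sum_ae_eq (I : choiceType) (F G : I -> X -> R[i]) f :
  cmeasurable f -> (forall i, L2 (G i)) -> (forall i, F i = G i %[ae mu]) ->
  L2_has_sum mu F f -> L2_has_sum mu G f.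
Proof.
move=> mf L2G FG [L2F Ff]; split=> //.
rewrite (_ : (fun J : {fset I} => _) = (fun J : {fset I} =>
    cLnorm mu 2%:E (fun x => f x - \sum_(i <- J) F i x)))//.
apply/funext => J; apply/esym/eq_norm2_ae.
- by apply: cmeasurableB => //; apply: cmeasurable_sum => i; case: (L2F i).
- by apply: cmeasurableB => //; apply: cmeasurable_sum => i; case: (L2G i).
suff sumE (r : seq I) :
    (fun x => \sum_(i <- r) F i x) = (fun x => \sum_(i <- r) G i x) %[ae mu].
  by apply: filterS (sumE J) => x /[apply] ->.
elim: r => [|i r IH]; first by apply: aeW => x _; rewrite !big_nil.
by apply: filterS2 (FG i) IH => x Fi Fr xT; rewrite !big_cons Fi// Fr.
Qed.

End CyclicVectors.

(** * Wavelet filters and representations of the Cuntz algebra *)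

Theorem theorem1p3 (R : realType) (d : measure_display) (X : measurableType d)
    (mu : probability X R) (sigma : {mfun X >-> X})
    (Lambda : countType) (m : Lambda -> X -> R[i])
    (X_borel : standard_borel R X)
    (mu_nonatomic : nonatomic mu)
    (sigma_surj : range sigma = [set: X])
    (sigma_inv : measure_invariant mu sigma)
    (m_cyclic : cyclic_vectors mu sigma m)
    (m_norm : forall i,
       Sstar mu sigma (fun x => (normc (m i x) ^+ 2)%:C) = cst 1 %[ae mu]) :
  let S := fun i => filter_op sigma (m i) in
  (wavelet_filters mu sigma m <->
     strong_sum_is_id mu (fun i => TTadj mu (S i))) /\
  (wavelet_filters mu sigma m <-> cuntz_generators mu S).
Proof.
move=> S; have [L2m orth _] := m_cyclic.
have ortho i j : i != j ->
    Sstar mu sigma (fun x => m i x * (m j x)^*) = cst 0 %[ae mu].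
  move=> ij; apply: cyclic_orthogonal_Sstar => // f g.
  exact: orth.
have filter_sum : wavelet_filters mu sigma m <->
    strong_sum_is_id mu (fun i => TTadj mu (S i)).
  split=> [[_ _ sum] f L2f|sum].
    have [mf _] := L2f; apply: (L2_has_sum_ae_eq mf) (sum f L2f) => i.
      exact: L2_TTadj.
    by apply: ae_eq_sym; exact: TTadj_filter_op.
  split=> // [i j|f L2f].
    have [<-|ij] := eqVneq i j; last exact: ortho.
    rewrite (_ : (fun x => _) = (fun x => (normc (m i x) ^+ 2)%:C)).
      exact: m_norm.
    by apply/funext => x; exact: mulc_conj.
  have [mf _] := L2f; apply: (L2_has_sum_ae_eq mf) (sum f L2f) => i.
    exact: L2_mul_Esigma.
  exact: TTadj_filter_op.
split=> //; rewrite filter_sum; split=> [sum|[_ _ //]].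
split=> // [i|i j f ij L2f]; first exact: filter_op_isometry.
by apply: TTadj_orthogonal => //; exact: ortho.
Qed.
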